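(* Let $k\ge 2$ and $G_k=\langle g,h\mid (h^{-1}g)^k=1\rangle$. There are exactly $k$ subsets $E\subseteq G_k$ such that $1\in E$, $gE=E\smallsetminus\{1\}$, and $hE=E\smallsetminus\{b\}$ for some $b\in E$; for exactly $k-1$ of them, $E$ is a $(g,h)$-wS-subset (with removable points $1$ and $b$). More precisely, these are the subsets $E_\ell$, $1\le \ell\le k$, where $E_\ell$ is the set of vertices of the connected component containing $1$ of the graph obtained from the Schreier graph $\Gamma(G_k,g,h)$ by removing the edge labeled $g$ from $g^{-1}$ to $1$ and the edge labeled $h$ from $g^{-1}(hg^{-1})^{\ell-1}$ to $(hg^{-1})^{\ell}$. We have $hE_\ell=E_\ell\smallsetminus\{b_\ell\}$ with $b_\ell=(hg^{-1})^{\ell}$, which equals $1$ for $\ell=k$ and is different from $1$ for $1\le \ell\le k-1$ (so that $E_\ell$ is a $(g,h)$-wS-subset for $1\le\ell\le k-1$). In particular, the action of $G_k$ by right translation on the set of $(g,h)$-wS-subsets of $G_k$ is free and has exactly $k-1$ orbits.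
   Context: For a group $G$ and $g,h\in G$, a subset $E\subseteq G$ is a $(g,h)$-wS-subset if there exist elements $a\neq b$ in $E$ (called removable points) such that $gE=E\smallsetminus\{a\}$ and $hE=E\smallsetminus\{b\}$, where $gE=\{gx: x\in E\}$. The Schreier graph $\Gamma(G,g,h)$ is the oriented labeled graph with vertex set $G$ and, for each $x\in G$, an edge from $x$ to $gx$ labeled $g$ and an edge from $x$ to $hx$ labeled $h$. Connected components are taken in the underlying unoriented graph. Right translation by $\gamma\in G$ sends a subset $E$ to $E\gamma=\{x\gamma: x\in E\}$. *)

(* Defs.v *)
From HB Require Import structures.
From Stdlib Require Import Relation_Operators.
#[warnings="-notation-overridden"]
From mathcomp Require Import all_boot generic_quotient.
From mathcomp Require Import boolp classical_sets cardinality.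

Set Implicit Arguments.
Unset Strict Implicit.
Unset Printing Implicit Defensive.

Local Open Scope quotient_scope.
Local Open Scope classical_set_scope.
Local Open Scope card_scope.
Local Open Scope group_scope.

Section Presentation.
Variables (X : choiceType) (R : set (seq (X * bool))).

(* A word is a sequence of letters [(x, false)], standing for the generator
   [x], and [(x, true)], standing for its inverse. *)
Definition word := seq (X * bool).

Implicit Types u v w r : word.

Definition word_inv w : word := rev [seq (a.1, ~~ a.2) | a <- w].

Variant word_step : word -> word -> Prop :=
  | StepCancel u v x b : word_step (u ++ [:: (x, b); (x, ~~ b)] ++ v) (u ++ v)
  | StepRel u v r of R r : word_step (u ++ r ++ v) (u ++ v).

Definition word_eq u v : bool :=
  `[< clos_refl_sym_trans word word_step u v >].

Lemma word_eq_refl : reflexive word_eq.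
Proof. by move=> u; apply/asboolP; apply: rst_refl. Qed.

Lemma word_eq_sym : symmetric word_eq.
Proof.
by move=> u v; apply/idP/idP => /asboolP H; apply/asboolP; apply: rst_sym.
Qed.

Lemma word_eq_trans : transitive word_eq.
Proof.
move=> v u w /asboolP H1 /asboolP H2; apply/asboolP.
exact: rst_trans H1 H2.
Qed.

Canonical word_equiv := EquivRel word_eq word_eq_refl word_eq_sym word_eq_trans.

(* The group with generators [X] and relators [R]. *)
Definition presented := {eq_quot word_equiv}.

HB.instance Definition _ : EqQuotient _ word_equiv presented :=
  EqQuotient.on presented.
HB.instance Definition _ := Choice.on presented.

Lemma word_eq_mono (f : word -> word) :
  (forall u v, word_step u v -> word_eq (f u) (f v)) ->
  forall u v, word_eq u v -> word_eq (f u) (f v).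
Proof.
move=> fP u v /asboolP; elim=> [a b /fP //|a|a b _|a b c _ ab _].
- exact: word_eq_refl.
- by rewrite word_eq_sym.
- exact: word_eq_trans.
Qed.

Lemma word_eq_catl w u v : word_eq u v -> word_eq (w ++ u) (w ++ v).
Proof.
move: u v; apply: word_eq_mono => _ _ [u v x b|u v r Rr];
  rewrite catA [w ++ (u ++ v)]catA; apply/asboolP; apply: rst_step.
- exact: StepCancel.
- exact: StepRel.
Qed.

Lemma word_eq_catr w u v : word_eq u v -> word_eq (u ++ w) (v ++ w).
Proof.
move: u v; apply: (word_eq_mono (f := fun u => u ++ w)).
move=> _ _ [u v x b|u v r Rr]; rewrite -!catA; apply/asboolP; apply: rst_step.
- exact: StepCancel.
- exact: StepRel.
Qed.

Lemma word_inv_cat u v : word_inv (u ++ v) = word_inv v ++ word_inv u.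
Proof. by rewrite /word_inv map_cat rev_cat. Qed.

Lemma word_invK : involutive word_inv.
Proof.
move=> w; rewrite /word_inv map_rev revK -map_comp -[RHS]map_id.
by apply: eq_map => -[x b] /=; rewrite negbK.
Qed.

Lemma word_eq_mulVw w : word_eq (word_inv w ++ w) [::].
Proof.
elim: w => [|[x b] w IHw]; first exact: word_eq_refl.
rewrite -cat1s word_inv_cat -catA; apply: (word_eq_trans _ IHw).
apply/asboolP; apply: rst_step.
by have := StepCancel (word_inv w) w x (~~ b); rewrite negbK.
Qed.

Lemma word_eq_mulwV w : word_eq (w ++ word_inv w) [::].
Proof. by have := word_eq_mulVw (word_inv w); rewrite word_invK. Qed.

Lemma word_eq_inv u v : word_eq u v -> word_eq (word_inv u) (word_inv v).
Proof.
move=> uv; apply: (@word_eq_trans (word_inv u ++ (v ++ word_inv v))).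
  rewrite word_eq_sym -[X in word_eq _ X]cats0.
  exact/word_eq_catl/word_eq_mulwV.
rewrite catA -[X in word_eq _ X]cat0s; apply: word_eq_catr.
apply: (@word_eq_trans (word_inv u ++ u)); last exact: word_eq_mulVw.
by apply: word_eq_catl; rewrite word_eq_sym.
Qed.

Lemma word_eq_pi u v : word_eq u v -> \pi_presented u = \pi_presented v.
Proof. by move=> uv; apply/eqmodP. Qed.

Lemma word_eq_repr w : word_eq (repr (\pi_presented w)) w.
Proof. by have /eqmodP := reprK (\pi_presented w). Qed.

Definition pres_one : presented := \pi_presented [::].
Definition pres_mul (a b : presented) : presented :=
  \pi_presented (repr a ++ repr b).
Definition pres_inv (a : presented) : presented :=
  \pi_presented (word_inv (repr a)).

Lemma pres_ind (P : presented -> Prop) :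
  (forall w, P (\pi_presented w)) -> forall a, P a.
Proof. by move=> Ppi a; rewrite -[a]reprK. Qed.

Lemma pres_mulE u v :
  pres_mul (\pi_presented u) (\pi_presented v) = \pi_presented (u ++ v).
Proof.
apply: word_eq_pi; apply: word_eq_trans (word_eq_catr _ (word_eq_repr u)) _.
exact/word_eq_catl/word_eq_repr.
Qed.

Lemma pres_invE u : pres_inv (\pi_presented u) = \pi_presented (word_inv u).
Proof. exact/word_eq_pi/word_eq_inv/word_eq_repr. Qed.

Lemma pres_mulA : associative pres_mul.
Proof.
by elim/pres_ind=> u; elim/pres_ind=> v; elim/pres_ind=> w;
  rewrite !pres_mulE catA.
Qed.

Lemma pres_mul1 : left_id pres_one pres_mul.
Proof. by elim/pres_ind=> u; rewrite pres_mulE. Qed.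

Lemma pres_mulr1 : right_id pres_one pres_mul.
Proof. by elim/pres_ind=> u; rewrite pres_mulE cats0. Qed.

Lemma pres_mulV : left_inverse pres_one pres_inv pres_mul.
Proof.
by elim/pres_ind=> u; rewrite pres_invE pres_mulE;
  apply/word_eq_pi/word_eq_mulVw.
Qed.

Lemma pres_mulrV : right_inverse pres_one pres_inv pres_mul.
Proof.
by elim/pres_ind=> u; rewrite pres_invE pres_mulE;
  apply/word_eq_pi/word_eq_mulwV.
Qed.

HB.instance Definition _ := isGroup.Build presented
  pres_mulA pres_mul1 pres_mulr1 pres_mulV pres_mulrV.

Definition pres_gen (x : X) : presented := \pi_presented [:: (x, false)].

End Presentation.

(* The two letters serve both as generators of the presentation and as edge
   labels. *)
Variant letter := Lg | Lh.

Definition letter_bool (l : letter) : bool := if l is Lg then true else false.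
Definition bool_letter (b : bool) : letter := if b then Lg else Lh.

Lemma letter_boolK : cancel letter_bool bool_letter.
Proof. by case. Qed.

HB.instance Definition _ := Choice.copy letter (can_type letter_boolK).

(* The single relator (h^-1 g)^k. *)
Definition Gk_relator (k : nat) : word letter :=
  flatten (nseq k [:: (Lh, true); (Lg, false)]).

Definition Gk (k : nat) : groupType := presented [set Gk_relator k].
Definition Gk_g (k : nat) : Gk k := pres_gen _ Lg.
Definition Gk_h (k : nat) : Gk k := pres_gen _ Lh.

Section Subsets.
Variables (G : groupType) (g h : G).

Definition ltrans (x : G) (E : set G) : set G := [set x * y | y in E].
Definition rtrans (E : set G) (x : G) : set G := [set y * x | y in E].

Definition removable (E : set G) (a b : G) : Prop :=
  [/\ E a, E b, a <> b, ltrans g E = E `\ a & ltrans h E = E `\ b].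

Definition wS_subset (E : set G) : Prop := exists a b, removable E a b.

(* An oriented labeled graph on [V] is given by its set of edges
   (source, label, target). *)
Definition schreier : set (G * letter * G) :=
  [set (x, Lg, g * x) | x in setT] `|` [set (x, Lh, h * x) | x in setT].

End Subsets.

Definition component (V L : Type) (Gamma : set (V * L * V)) (x : V) : set V :=
  [set y | clos_refl_sym_trans V (fun u v => exists l, Gamma (u, l, v)) x y].

Section El.
Variables k l : nat.
Let g := Gk_g k.
Let h := Gk_h k.

Definition g_edge : Gk k * letter * Gk k := (g^-1, Lg, 1).
Definition h_edge : Gk k * letter * Gk k :=
  (g^-1 * (h * g^-1) ^+ l.-1, Lh, (h * g^-1) ^+ l).

Lemma g_edge_schreier : schreier g h g_edge.
Proof. by left; exists g^-1 => //; rewrite mulgV. Qed.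

Lemma h_edge_schreier : (0 < l)%N -> schreier g h h_edge.
Proof.
move=> l0; right; exists (g^-1 * (h * g^-1) ^+ l.-1) => //.
by rewrite /h_edge mulgA -expgS prednK.
Qed.

Definition El : set (Gk k) :=
  component (schreier g h `\` [set g_edge; h_edge]) 1.

Definition bl : Gk k := (h * g^-1) ^+ l.

End El.
Arguments El k l _ : clear implicits.

Section Actions.
Variables (G : groupType) (T : Type) (S : set T) (act : T -> G -> T).

Definition right_action_on : Prop :=
  [/\ forall x c, S x -> S (act x c),
      forall x, S x -> act x 1 = x
    & forall x c d, S x -> act (act x c) d = act x (c * d)].

Definition free_on : Prop := forall x c, S x -> act x c = x -> c = 1.

Definition orbits : set (set T) := [set [set act x c | c in setT] | x in S].

End Actions.

(* Main.v *)
(** Write [t = h g^-1], so that [G_k] is generated by [g] and [t] subject to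
    [t^k = 1] only. A set [E] containing [a] satisfies [gE = E \ {a}] exactly
    when its indicator is unchanged along all [g]-edges except the one into
    [a], whose source is outside [E]. Hence [E] is determined by [1] and [b],
    and following the cycle [1 <-h- g^-1 t^-1 -g-> t^-1 <-h- ...] from [1] back
    to [g^-1], which must leave [E], shows that [b = t^l] for some
    [1 <= l <= k]. Conversely the two removed edges cut this cycle into two
    arcs, one through [1] and [t^l] and the other through [g^-1] and
    [g^-1 t^(l-1)]; that the arcs are not connected in the rest of the graph
    is seen from a parity cocycle on [G_k] that changes exactly along the two
    removed edges. *)
Require Import Defs.
From Stdlib Require Import Relation_Operators.
From mathcomp Require Import all_boot generic_quotient.
From mathcomp Require Import boolp classical_sets cardinality.

Local Open Scope quotient_scope.
Local Open Scope classical_set_scope.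
Local Open Scope card_scope.
Local Open Scope group_scope.

Set Implicit Arguments.
Unset Strict Implicit.
Unset Printing Implicit Defensive.

(** * Induction and actions for presented groups *)

Section PresentedGroups.
Variables (X : choiceType) (R : set (seq (X * bool))).

Lemma presented_ind (P : presented R -> Prop) :
  P 1 -> (forall x y, P y -> P (pres_gen R x * y)) ->
  (forall x y, P y -> P ((pres_gen R x)^-1 * y)) -> forall y, P y.
Proof.
move=> P1 Pg PV; apply: pres_ind; elim=> [|[x b] w Pw]; first exact: P1.
suff -> : \pi_(presented R) ((x, b) :: w) =
    (if b then (pres_gen R x)^-1 else pres_gen R x) * \pi_(presented R) w.
  by case: b; [apply: PV | apply: Pg].
case: b; last by rewrite -[RHS]/(pres_mul _ _) pres_mulE.
by rewrite -[RHS]/(pres_mul (pres_inv _) _) pres_invE pres_mulE.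
Qed.

(** The universal property of the presentation in terms of actions: words act letter by letter, and
    each elementary step between words leaves this unchanged. It serves to tell elements apart. *)
Lemma presented_action (T : Type) (s s' : X -> T -> T) :
  (forall x, cancel (s x) (s' x)) -> (forall x, cancel (s' x) (s x)) ->
  (forall r, R r -> forall z,
     foldr (fun a => if a.2 then s' a.1 else s a.1) z r = z) ->
  exists F : presented R -> T -> T,
    [/\ forall z, F 1 z = z, forall x y z, F (x * y) z = F x (F y z)
      & forall x z, F (pres_gen R x) z = s x z].
Proof.
move=> sK s'K relK; set a := (fun a => _) in relK.
have aE u v : word_eq R u v -> forall z, foldr a z u = foldr a z v.
  move=> /asboolP; elim=> [{}u {}v [{}u {}v x|{}u {}v r Rr]||{}u {}v _ IH z|{}u {}v w _ IH1 _ IH2 z].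
  - by case=> z; rewrite !foldr_cat /a /= ?sK ?s'K.
  - by move=> z; rewrite !foldr_cat (relK r Rr).
  - by [].
  - by rewrite IH.
  - by rewrite IH1 IH2.
have reprE w z : foldr a z (repr (\pi_(presented R) w)) = foldr a z w.
  exact/aE/word_eq_repr.
exists (fun y z => foldr a z (repr y)); split=> [z|x y z|x z].
- exact: reprE.
- by rewrite (reprE (repr x ++ repr y)) foldr_cat.
- exact: reprE.
Qed.

End PresentedGroups.

(** * Translates missing one point *)

Section AlmostInvariantSets.
Variable G : groupType.
Implicit Types (g a b : G) (E : set G).

Definition almost_invariant g a E := forall x, g * x <> a -> (E x <-> E (g * x)).

(** Turns the equation of sets into a local condition along [g]-edges: [a] is missing from the
    translate because its predecessor is outside [E], and no other edge crosses the boundary of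
    [E]. *)
Lemma ltrans_setD1P g a E : E a ->
  ltrans g E = E `\ a <-> ~ E (g^-1 * a) /\ almost_invariant g a E.
Proof.
move=> Ea; split=> [gE|[nEa inv]].
  split=> [Ega|x gxa].
    have : ltrans g E a by exists (g^-1 * a); rewrite ?mulVKg.
    by rewrite gE => -[_]; apply.
  split=> [Ex|Egx].
    by have : ltrans g E (g * x) by [exists x]; rewrite gE => -[].
  have : (E `\ a) (g * x) by [].
  by rewrite -gE => -[y Ey /mulgI <-].
rewrite eqEsubset; split=> [_ [x Ex <-]|y [Ey ya]].
  have gxa : g * x <> a by move=> gxa; apply: nEa; rewrite -gxa mulKg.
  by split=> //; apply/(inv _ gxa).
exists (g^-1 * y); last by rewrite mulVKg.
by apply/inv; rewrite mulVKg.
Qed.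

Lemma setD1_inj E a b : E a -> E b -> E `\ a = E `\ b -> a = b.
Proof.
move=> Ea Eb eqE; apply: contrapT => ab.
by have : (E `\ b) a by []; rewrite -eqE => -[_]; apply.
Qed.

Lemma rtransM E a b : rtrans (rtrans E a) b = rtrans E (a * b).
Proof.
rewrite eqEsubset; split=> [_ [_ [x Ex <-] <-]|_ [x Ex <-]].
  by exists x; rewrite ?mulgA.
by exists (x * a); [exists x | rewrite mulgA].
Qed.

Lemma rtrans1 E : rtrans E 1 = E.
Proof.
rewrite eqEsubset; split=> [_ [x Ex <-]|x Ex]; first by rewrite mulg1.
by exists x; rewrite ?mulg1.
Qed.

Lemma ltrans_rtrans g E a b :
  ltrans g E = E `\ a -> ltrans g (rtrans E b) = rtrans E b `\ (a * b).
Proof.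
move=> gE; rewrite eqEsubset; split=> [_ [_ [x Ex <-] <-]|_ [[x Ex <-] xa]].
  have : ltrans g E (g * x) by exists x.
  rewrite gE => -[Egx gxa]; split; first by exists (g * x); rewrite ?mulgA.
  by rewrite mulgA => /= /mulIg.
have : (E `\ a) x by split=> // xa'; apply: xa; rewrite xa'.
by rewrite -gE => -[y Ey <-]; exists (y * b); [exists y | rewrite mulgA].
Qed.

Lemma removable_rtrans g h E a b c :
  removable g h E a b -> removable g h (rtrans E c) (a * c) (b * c).
Proof.
move=> [Ea Eb ab gE hE]; split; [by exists a | by exists b | | | ].
- by move/mulIg.
- exact: ltrans_rtrans.
- exact: ltrans_rtrans.
Qed.

End AlmostInvariantSets.

(** * Relations in [Gk k], the order of [t], and a separating set *)

Section Gk.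
Variable k : nat.
Let g := Gk_g k.
Let h := Gk_h k.
Let t := h * g^-1.

Lemma Gk_ind (P : Gk k -> Prop) :
  P 1 -> (forall y, P y -> P (g * y)) -> (forall y, P y -> P (g^-1 * y)) ->
  (forall y, P y -> P (h * y)) -> (forall y, P y -> P (h^-1 * y)) ->
  forall y, P y.
Proof.
move=> P1 Pg PgV Ph PhV; apply: presented_ind => //.
- by case=> y; [apply: Pg | apply: Ph].
- by case=> y; [apply: PgV | apply: PhV].
Qed.

Lemma Gk_action (T : Type) (sg sg' sh sh' : T -> T) :
  cancel sg sg' -> cancel sg' sg -> cancel sh sh' -> cancel sh' sh ->
  (forall z, iter k (sh' \o sg) z = z) ->
  exists F : Gk k -> T -> T,
    [/\ forall z, F 1 z = z, forall x y z, F (x * y) z = F x (F y z),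
        forall z, F g z = sg z & forall z, F h z = sh z].
Proof.
move=> gK g'K hK h'K relK.
pose s l := if l is Lg then sg else sh.
pose s' l := if l is Lg then sg' else sh'.
have [|||F [F1 FM Fgen]] := @presented_action _ [set Gk_relator k] T s s'.
- by case.
- by case.
- move=> _ -> z; rewrite -[RHS]relK /Gk_relator.
  by elim: k => //= n ->.
by exists F; split=> // z; rewrite Fgen.
Qed.

Lemma Gk_relator_eq1 : (h^-1 * g) ^+ k = 1.
Proof.
have expE n : (h^-1 * g) ^+ n =
    \pi_(Gk k) (flatten (nseq n [:: (Lh, true); (Lg, false)])).
  elim: n => // n IH; rewrite expgS IH.
  rewrite -mulgA -[LHS]/(pres_mul (pres_inv _) (pres_mul _ _)).
  by rewrite (pres_mulE _ [:: (Lg, false)]) pres_invE pres_mulE.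
rewrite expE; apply/word_eq_pi/asboolP/rst_step.
by rewrite -[X in word_step _ X _]cats0; apply: (@StepRel _ _ [::] [::]).
Qed.

Lemma hgV_expk : t ^+ k = 1.
Proof.
have -> : t = ((h^-1 * g)^-1) ^ h^-1.
  by rewrite /conjg invgK invgM invgK !mulgA mulgK.
by rewrite -conjXg expVgn Gk_relator_eq1 invg1 conj1g.
Qed.

(** Let [g] act trivially on the integers modulo [k] and [h] by the cyclic shift; then [t ^+ j]
    sends [0] to [j]. *)
Lemma hgV_exp_neq1 j : (0 < j < k)%N -> t ^+ j <> 1.
Proof.
move=> /andP[j0 jk] tj1.
have k0 : (0 < k)%N by apply: leq_trans jk.
have val_iter n (z : 'I_k) : val (iter n (@ordS k) z) = (z + n) %% k :> nat.
  elim: n => [|n IH] /=; first by rewrite addn0 modn_small.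
  by rewrite IH -addn1 modnDml addn1 addnS.
have iterK n (z : 'I_k) : iter n (@ord_pred k) (iter n (@ordS k) z) = z.
  by elim: n => // n IH; rewrite iterSr iterS ordSK.
have [||||z|F [F1 FM Fg Fh]] := @Gk_action 'I_k id id (@ordS k) (@ord_pred k).
- by [].
- by [].
- exact: ordSK.
- exact: ord_predK.
- rewrite -[RHS](iterK k); congr (iter _ _ _).
  by apply/val_inj; rewrite val_iter modnDr modn_small.
have FgV z : F g^-1 z = z by rewrite -[LHS]Fg -FM mulgV F1.
have Ft n z : F (t ^+ n) z = iter n (@ordS k) z.
  by elim: n z => [|n IH] z //; rewrite expgS FM IH FM FgV Fh.
have := val_iter j (Ordinal k0); rewrite -Ft tj1 F1 /= add0n modn_small // => j0'.
by rewrite -j0' in j0.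
Qed.

Lemma hgV_exp_inj i j : (1 <= i <= k)%N -> (1 <= j <= k)%N ->
  t ^+ i = t ^+ j -> i = j.
Proof.
wlog ij : i j / (i <= j)%N => [wl|].
  by case/orP: (leq_total i j) => ij hi hj; [|move/esym] => /wl-> //.
move=> /andP[i1 ik] /andP[j1 jk] tij; apply/eqP; rewrite eqn_leq ij /= leqNgt.
apply/negP => ltij; apply: (@hgV_exp_neq1 (j - i)).
  by rewrite subn_gt0 ltij /=; apply: leq_trans jk; rewrite ltn_subrL i1 j1.
by rewrite expgnFr // tij mulgV.
Qed.

(* [G_k] acts on [G_k x bool] so that the second component is flipped exactly
   along the two edges. The relator moves the point around a cycle, and the
   flips cancel since, for [p] the parity of [#{i < l | y = t^i}], the sum
   [p y + p (t^-1 y)] counts the crossings of both edges. *)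
Lemma separating_set l : exists A : set (Gk k),
  [/\ A 1, ~ A g^-1, almost_invariant g 1 A & almost_invariant h (t ^+ l) A].
Proof.
pose s (x a : Gk k) (z : Gk k * bool) := (x * z.1, z.2 (+) (x * z.1 == a)).
pose s' (x a : Gk k) (z : Gk k * bool) := (x^-1 * z.1, z.2 (+) (z.1 == a)).
have sK x a : cancel (s x a) (s' x a).
  by move=> [y c]; rewrite /s /s' /= mulKg addbK.
have s'K x a : cancel (s' x a) (s x a).
  by move=> [y c]; rewrite /s /s' /= mulVKg addbK.
pose p y := \big[addb/false]_(i < l) (y == t ^+ i).
have pE y : p (t^-1 * y) = p y (+) (y == 1) (+) (y == t ^+ l).
  have shiftE i : (t^-1 * y == t ^+ i) = (y == t ^+ i.+1).
    by rewrite expgS -(inj_eq (mulgI t)) mulVKg.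
  rewrite /p; under eq_bigr do rewrite shiftE.
  clear p; elim: l => [|n IH]; first by rewrite !big_ord0 /= addbb.
  rewrite !big_ord_recr /= IH /=.
  by case: (y == 1); case: (y == t ^+ n); case: (y == t ^+ n.+1);
     case: (\big[addb/false]_(i < n) _).
have [|||||F [F1 FM Fg Fh]] := @Gk_action _ (s g 1) (s' g 1)
    (s h (t ^+ l)) (s' h (t ^+ l)); [by []..| |].
  (* By [pE], the flips during one turn [h^-1 * g] equal the change of [p], so [J] is invariant:
     once the first component returns, so does the second. *)
  pose J (z : Gk k * bool) := z.2 (+) p (g * z.1).
  have JE n z : let z' := iter n (s' h (t ^+ l) \o s g 1) z in
      z'.1 = (h^-1 * g) ^+ n * z.1 /\ J z' = J z.
    elim: n => [|n [IH1 IH2]] /=; first by rewrite mul1g.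
    rewrite expgS -mulgA -IH1 -IH2; split; first by rewrite mulgA.
    set z' := iter _ _ _; rewrite /J /=.
    have -> : g * (h^-1 * (g * z'.1)) = t^-1 * (g * z'.1).
      by rewrite /t invgM invgK !mulgA.
    rewrite pE; case: (g * z'.1 == 1); case: (g * z'.1 == t ^+ l);
      by case: z'.2; case: (p _).
  move=> z; have [] := JE k z; rewrite Gk_relator_eq1 mul1g /J.
  case: z (iter _ _ _) => [y c] [y' c'] /= -> /(congr1 (addb^~ (p (g * y)))).
  by rewrite -!addbA addbb !addbF => ->.
have FE x z : (F x z).1 = x * z.1.
  elim/Gk_ind: x => [|x|x|x|x]; rewrite ?F1 ?mul1g // => IH.
  - by rewrite FM Fg /= IH mulgA.
  - by apply: (mulgI g); rewrite -mulgA mulVKg -IH -[in RHS](mulVKg g x) (FM g) Fg.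
  - by rewrite FM Fh /= IH mulgA.
  - by apply: (mulgI h); rewrite -mulgA mulVKg -IH -[in RHS](mulVKg h x) (FM h) Fh.
have inv x a w : (forall z, F x z = s x a z) ->
    (F (x * w) (1, true)).2 = (F w (1, true)).2 (+) (x * w == a).
  by move=> Fx; rewrite FM Fx /= FE mulg1.
exists [set x | (F x (1, true)).2]; split=> /=.
- by rewrite F1.
- by have := inv g 1 g^-1 Fg; rewrite mulgV F1 eqxx addbT => /esym/negP.
- by move=> x /eqP/negbTE gx; rewrite /= (inv _ _ _ Fg) gx addbF.
- by move=> x /eqP/negbTE hx; rewrite /= (inv _ _ _ Fh) hx addbF.
Qed.

(** * The component of [1] after removing the two edges *)

Section TwoRemovedEdges.
Variable l : nat.
Hypothesis l_bounds : (1 <= l <= k)%N.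

Let l_gt0 : (0 < l)%N. Proof. by case/andP: l_bounds. Qed.

Lemma mulh_hgV_exp j : h * (g^-1 * t ^+ j) = t ^+ j.+1.
Proof. by rewrite mulgA expgS. Qed.

Lemma mulhV_bl : h^-1 * bl k l = g^-1 * t ^+ l.-1.
Proof. by rewrite /bl -[in LHS](prednK l_gt0) -mulh_hgV_exp mulKg. Qed.

Let Gamma := schreier g h `\` [set g_edge k; h_edge k l].

Lemma kept_edge_g x : g * x <> 1 -> Gamma (x, Lg, g * x).
Proof. by move=> gx; split; [left; exists x | move=> [[_ /gx]|[]]]. Qed.

Lemma kept_edge_h x : h * x <> bl k l -> Gamma (x, Lh, h * x).
Proof. by move=> hx; split; [right; exists x | move=> [[]|[_ /hx]]]. Qed.

Lemma kept_edgeP x e y : Gamma (x, e, y) ->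
  (y = g * x /\ y <> 1) \/ (y = h * x /\ y <> bl k l).
Proof.
move=> [[[z _ [<- <- <-]]|[z _ [<- <- <-]]] kept]; [left | right]; split=> //.
- move=> gz1; apply: kept; left; rewrite /= /g_edge gz1.
  by congr (_, _, _); rewrite -[z](mulKg g) gz1 mulg1.
- move=> hzl; apply: kept; right; rewrite /= /h_edge hzl.
  by congr (_, _, _); rewrite -[z](mulKg h) hzl mulhV_bl.
Qed.

Lemma El1 : El k l 1.
Proof. exact: rst_refl. Qed.

Lemma El_edge x e y : Gamma (x, e, y) -> El k l x <-> El k l y.
Proof.
move=> xy; split=> Elx; apply: rst_trans Elx _; last apply: rst_sym;
  by apply: rst_step; exists e.
Qed.

Lemma El_invariant_g : almost_invariant g 1 (El k l).
Proof. by move=> x /kept_edge_g; apply: El_edge. Qed.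

Lemma El_invariant_h : almost_invariant h (bl k l) (El k l).
Proof. by move=> x /kept_edge_h; apply: El_edge. Qed.

(** Membership in [A] is constant along kept edges, hence on components. A separating set thus
    bounds the component from above. *)
Lemma El_sub (A : set (Gk k)) : A 1 -> almost_invariant g 1 A ->
  almost_invariant h (bl k l) A -> El k l `<=` A.
Proof.
move=> A1 Ag Ah y; rewrite /El /component /=.
suff AE u v : clos_refl_sym_trans (Gk k)
    (fun u v => exists e, Gamma (u, e, v)) u v -> (A u <-> A v).
  by move/AE => [+ _]; apply.
elim=> {u v} [u v [e /kept_edgeP[[-> /Ag]|[-> /Ah]]]||u v _ IH|u v w _ IH1 _ IH2] //.
- exact: iff_sym.
- exact: iff_trans IH1 IH2.
Qed.

(** Walk from [g^-1 * t ^+ i] along [h] to [t ^+ i.+1], then back along [g]; for [i.+1 < l] neither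
    removed edge is met. *)
Lemma arc_gV (A : set (Gk k)) : almost_invariant g 1 A ->
  almost_invariant h (bl k l) A -> A g^-1 <-> A (g^-1 * t ^+ l.-1).
Proof.
move=> Ag Ah; have : (l.-1 < l)%N by rewrite prednK.
elim: l.-1 => [|i IH] il; first by rewrite mulg1.
have lk : (l <= k)%N by case/andP: l_bounds.
apply: iff_trans (IH (ltnW il)) _.
have til : t ^+ i.+1 <> bl k l.
  move/hgV_exp_inj => e; have {}e := e (leq_trans (ltnW il) lk) l_bounds.
  by rewrite e ltnn in il.
have ti1 : t ^+ i.+1 <> 1 by apply: hgV_exp_neq1; rewrite (leq_trans il).
apply: iff_trans (Ah _ _) _; rewrite mulh_hgV_exp //.
by apply: iff_sym; rewrite -[X in _ <-> A X](mulVKg g); apply: Ag; rewrite mulVKg.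
Qed.

(** The complementary arc: start at [1 = t ^+ k] and lower the exponent, back along [h] and forward
    along [g], until it reaches [l]. *)
Lemma arc_1 (A : set (Gk k)) : A 1 -> almost_invariant g 1 A ->
  almost_invariant h (bl k l) A -> A (bl k l).
Proof.
move=> A1 Ag Ah; have [_ lk] := andP l_bounds.
suff At i : (i <= k - l)%N -> A (t ^+ (k - i)).
  by have := At _ (leqnn _); rewrite subKn.
elim: i => [|i IH] ikl; first by rewrite subn0 hgV_expk.
have lki : (l <= k - i.+1)%N by rewrite leq_subCr // (leq_trans ikl) ?leq_subr.
have kiS : (k - i = (k - i.+1).+1)%N.
  by rewrite subnSK // (leq_trans ikl) ?leq_subr.
have Agt : A (g^-1 * t ^+ (k - i.+1)).
  apply: (Ah _ _).2; last by rewrite mulh_hgV_exp -kiS; apply/IH/ltnW.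
  rewrite mulh_hgV_exp -kiS => /hgV_exp_inj e.
  have {}e : (k - i = l)%N by apply: e => //; rewrite leq_subr kiS.
  by rewrite -e kiS ltnn in lki.
rewrite -[t ^+ _](mulVKg g); apply: (Ag _ _).1 => //.
rewrite mulVKg; apply: hgV_exp_neq1.
by rewrite (leq_trans l_gt0 lki) -kiS leq_subr.
Qed.

Lemma El_bl : El k l (bl k l).
Proof. exact: arc_1 El1 El_invariant_g El_invariant_h. Qed.

Lemma ltrans_g_El : ltrans g (El k l) = El k l `\ 1.
Proof.
apply/(ltrans_setD1P _ El1); split; last exact: El_invariant_g.
have [A [A1 AgV Ag Ah]] := separating_set l.
by rewrite mulg1 => /(El_sub A1 Ag Ah).
Qed.

Lemma ltrans_h_El : ltrans h (El k l) = El k l `\ bl k l.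
Proof.
apply/(ltrans_setD1P _ El_bl); split; last exact: El_invariant_h.
have [A [A1 AgV Ag Ah]] := separating_set l.
(* The source of the removed [h]-edge is joined to [g^-1] by an arc, so it too lies outside [A]. *)
by rewrite mulhV_bl => /(El_sub A1 Ag Ah)/(arc_gV Ag Ah).
Qed.

End TwoRemovedEdges.

(** * Classification of the subsets *)

(** Agreement of [E] and [F] spreads from [1] along all edges: both are constant on an ordinary
    edge, and on an exceptional one the target is in both, the source in neither. *)
Lemma almost_invariant_unique b (E F : set (Gk k)) : E 1 -> F 1 -> E b -> F b ->
  ltrans g E = E `\ 1 -> ltrans h E = E `\ b ->
  ltrans g F = F `\ 1 -> ltrans h F = F `\ b -> E = F.
Proof.
move=> E1 F1 Eb Fb /(ltrans_setD1P _ E1)[nEg Eg] /(ltrans_setD1P _ Eb)[nEh Eh].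
move=> /(ltrans_setD1P _ F1)[nFg Fg] /(ltrans_setD1P _ Fb)[nFh Fh].
have up x a y : E a -> F a -> almost_invariant x a E -> almost_invariant x a F ->
    (E y <-> F y) -> (E (x * y) <-> F (x * y)).
  move=> Ea Fa Ex Fx EF; have [->//|/eqP xya] := eqVneq (x * y) a.
  by rewrite -(propext (Ex _ xya)) -(propext (Fx _ xya)).
have down x a y : ~ E (x^-1 * a) -> ~ F (x^-1 * a) -> almost_invariant x a E ->
    almost_invariant x a F -> (E y <-> F y) -> (E (x^-1 * y) <-> F (x^-1 * y)).
  move=> nEa nFa Ex Fx EF; have [->//|/eqP ya] := eqVneq y a.
  have xya : x * (x^-1 * y) <> a by rewrite mulVKg.
  by rewrite (propext (Ex _ xya)) (propext (Fx _ xya)) mulVKg.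
apply/funext => y; apply/propext; elim/Gk_ind: y => [//|y|y|y|y].
- exact: (up g 1).
- exact: (down g 1).
- exact: (up h b).
- exact: (down h b).
Qed.

Lemma eq_El b (E : set (Gk k)) : (0 < k)%N -> E 1 -> E b ->
  ltrans g E = E `\ 1 -> ltrans h E = E `\ b ->
  exists2 l, (1 <= l <= k)%N & E = El k l.
Proof.
move=> k0 E1 Eb gE hE.
have [l lk bE] : exists2 l, (1 <= l <= k)%N & b = bl k l.
  (* If [b] is no power of [t], nothing blocks the walk around the whole cycle from [1], which ends
     at the forbidden point [g^-1]. *)
  apply: contrapT => bt.
  have [nEg Eg] := (ltrans_setD1P g E1).1 gE.
  have [nEh Eh] := (ltrans_setD1P h Eb).1 hE.
  have back j : (j < k)%N -> E (t ^+ j.+1) -> E (g^-1 * t ^+ j).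
    move=> jk Et; apply: (Eh _ _).2; rewrite mulh_hgV_exp // => bE.
    by apply: bt; exists j.+1.
  (* The exceptional target [y = 1] is harmless, since [1] is in [E]. *)
  have forth y : E (g^-1 * y) -> E y.
    have [->//|/eqP y1 EgVy] := eqVneq y 1.
    by rewrite -[y](mulVKg g); apply: (Eg _ _).1; rewrite ?mulVKg.
  have Et i : (i <= k)%N -> E (t ^+ (k - i)).
    elim: i => [|i IH] ik; first by rewrite subn0 hgV_expk.
    by apply/forth/back; rewrite subnSK ?leq_subr //; apply/IH/ltnW.
  apply: nEg; apply: (back 0) => //; have := Et k.-1 (leq_pred k).
  by rewrite -subn1 subKn.
exists l => //.
have := El_bl lk; have := ltrans_h_El lk; rewrite -bE => hEl Elb.
by apply: (almost_invariant_unique E1 (El1 l) Eb) => //; apply: ltrans_g_El.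
Qed.

(** The set determines [bl] as the point its [h]-translate misses, and the exponent in this range
    follows. *)
Lemma El_inj i j : (1 <= i <= k)%N -> (1 <= j <= k)%N ->
  El k i = El k j -> i = j.
Proof.
move=> hi hj eqE; apply: hgV_exp_inj => //.
apply: (setD1_inj (E := El k i)); first exact: El_bl.
  by rewrite eqE; apply: El_bl.
by rewrite -(ltrans_h_El hi) eqE (ltrans_h_El hj).
Qed.

Lemma bl_k : bl k k = 1.
Proof. exact: hgV_expk. Qed.

Lemma removable_El l : (1 <= l <= k.-1)%N ->
  removable g h (El k l) 1 (bl k l).
Proof.
move=> /andP[l1 lk].
have {}lk : (l < k)%N by rewrite -(prednK l1) -ltn_predRL prednK.
have hl : (1 <= l <= k)%N by rewrite l1 ltnW.
split; [exact: El1 | exact: El_bl | | exact: ltrans_g_El | exact: ltrans_h_El].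
by move=> /esym; apply: hgV_exp_neq1; rewrite l1.
Qed.

Lemma removable_unique (E : set (Gk k)) a b a' b' :
  removable g h E a b -> E a' -> E b' ->
  ltrans g E = E `\ a' -> ltrans h E = E `\ b' -> a = a' /\ b = b'.
Proof.
move=> [Ea Eb _ gE hE] Ea' Eb' gE' hE'.
by split; apply: (@setD1_inj _ E) => //; [rewrite -gE | rewrite -hE].
Qed.

Lemma removable1_El (E : set (Gk k)) b : (0 < k)%N -> removable g h E 1 b ->
  exists2 l, (1 <= l <= k.-1)%N & E = El k l.
Proof.
move=> k0 rE; have [E1 Eb nb gE hE] := rE.
have [l hl EE] := eq_El k0 E1 Eb gE hE; exists l => //.
have [l1 lk] := andP hl; rewrite l1 -ltnS prednK // ltn_neqAle lk andbT.
(* The value [l = k] would make both removable points equal to [1]. *)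
apply/eqP => lE; apply: nb; apply: (setD1_inj E1 Eb).
by rewrite -hE EE ltrans_h_El // lE bl_k.
Qed.

End Gk.

(** * Counting subsets and orbits *)

Theorem proposition3p5 (k : nat) (hk : (2 <= k)%N) :
  let g := Gk_g k in
  let h := Gk_h k in
  let P := [set E : set (Gk k) | [/\ E 1, ltrans g E = E `\ 1 &
                                  exists2 b, E b & ltrans h E = E `\ b]] in
  let W := [set E : set (Gk k) | wS_subset g h E] in
  [/\ (* exactly k such subsets, exactly k - 1 of which are wS-subsets, with
         removable points 1 and b *)
      [/\ P #= `I_k,
          P `&` W #= `I_(k.-1)
        & forall (E : set (Gk k)) (b : Gk k), P E -> W E ->
            E b -> ltrans h E = E `\ b -> removable g h E 1 b],
      P = [set El k l | l in [set l | (1 <= l <= k)%N]],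
      [/\ forall l, (1 <= l <= k)%N ->
            El k l (bl k l) /\ ltrans h (El k l) = El k l `\ bl k l,
          bl k k = 1
        & forall l, (1 <= l <= k.-1)%N ->
            bl k l <> 1 /\ removable g h (El k l) 1 (bl k l)]
    & [/\ right_action_on W (@rtrans (Gk k)),
          free_on W (@rtrans (Gk k))
        & orbits W (@rtrans (Gk k)) #= `I_(k.-1)]].
Proof.
move=> g h P W; have k0 : (0 < k)%N by apply: ltnW.
have pred_bound l : (1 <= l <= k.-1)%N -> (1 <= l <= k)%N.
  by case/andP=> -> /= lk; apply: leq_trans lk (leq_pred k).
have ltS n i : `I_n i -> (1 <= i.+1 <= n)%N by [].
have imageS (U : Type) (F : nat -> U) n :
    [set F l | l in [set l | (1 <= l <= n)%N]] = [set F i.+1 | i in `I_n].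
  rewrite eqEsubset; split=> [_ [[|l] //= hl <-]|_ [i hi <-]].
    by exists l.
  by exists i.+1.
have PE : P = [set El k l | l in [set l | (1 <= l <= k)%N]].
  rewrite eqEsubset; split=> [E [E1 gE [b Eb hE]]|_ [l hl <-]].
    by have [l hl ->] := eq_El k0 E1 Eb gE hE; exists l.
  split; [exact: El1 | exact: ltrans_g_El | exists (bl k l)].
    exact: El_bl.
  exact: ltrans_h_El.
have PW_removable E b : P E -> W E -> E b -> ltrans h E = E `\ b ->
    removable g h E 1 b.
  move=> [E1 gE _] [a [b' rE]] Eb hE.
  by have [<- <-] := removable_unique rE E1 Eb gE hE.
have PWE : P `&` W = [set El k l | l in [set l | (1 <= l <= k.-1)%N]].
  rewrite eqEsubset; split=> [E [PE' WE]|_ [l hl <-]].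
    have [_ _ [b Eb hE]] := PE'.
    have [l hl ->] := removable1_El k0 (PW_removable _ _ PE' WE Eb hE).
    by exists l.
  split; first by rewrite PE; exists l => //; apply: pred_bound.
  by exists 1, (bl k l); apply: removable_El.
split=> //; split=> //.
- rewrite PE imageS; apply: inj_card_eq => i j; rewrite !inE => hi hj.
  by case/(El_inj (ltS _ _ hi) (ltS _ _ hj)).
- rewrite PWE imageS; apply: inj_card_eq => i j; rewrite !inE => hi hj.
  by case/(El_inj (pred_bound _ (ltS _ _ hi)) (pred_bound _ (ltS _ _ hj))).
- by move=> l hl; split; [apply: El_bl | apply: ltrans_h_El].
- exact: bl_k.
- move=> l hl; have rl := removable_El hl; split=> //.
  by have [_ _ + _ _] := rl => /[swap] ->.
- split=> [E c [a [b rE]]|E _|E c d _].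
  + by exists (a * c), (b * c); apply: removable_rtrans.
  + exact: rtrans1.
  + exact: rtransM.
(* If [c] fixes [E], then [a] and [a * c] are both the point missed by the [g]-translate. *)
- move=> E c [a [b rE]] Ec; have := removable_rtrans c rE; rewrite Ec => rEc.
  have [Eac Ebc _ gE hE] := rEc.
  have [ac _] := removable_unique rE Eac Ebc gE hE.
  by apply: (mulgI a); rewrite mulg1 -ac.
have -> : orbits W (@rtrans (Gk k)) =
    [set [set rtrans (El k i.+1) c | c in setT] | i in `I_k.-1].
  rewrite -(imageS _ (fun l => [set rtrans (El k l) c | c in setT])).
  rewrite eqEsubset; split=> [_ [E [a [b rE]] <-]|_ [l hl <-]]; last first.
    by exists (El k l) => //; exists 1, (bl k l); apply: removable_El.
  (* Translation by [a^-1] moves the first removable point to [1], so every orbit meets the family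
     [El]. *)
  have := removable_rtrans a^-1 rE; rewrite mulgV => /(removable1_El k0)[l hl El_].
  exists l => //; rewrite -El_ eqEsubset; split=> _ [c _ <-].
    by exists (a^-1 * c); rewrite ?rtransM.
  by exists (a * c); rewrite // rtransM mulKg.
apply: inj_card_eq => i j; rewrite !inE => hi hj orbE.
have [c _ Ec] : [set rtrans (El k i.+1) c | c in setT] (El k j.+1).
  by rewrite orbE; exists 1; rewrite ?rtrans1.
(* The translate by [c] has first removable point [c], while [El k j.+1] has [1]; hence [c = 1]. *)
have := removable_rtrans c (removable_El (ltS _ _ hi)); rewrite Ec mul1g => rE.
have [E1 Eb _ gE hE] := removable_El (ltS _ _ hj).
have [c1 _] := removable_unique rE E1 Eb gE hE.
move: Ec; rewrite c1 rtrans1.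
by case/(El_inj (pred_bound _ (ltS _ _ hi)) (pred_bound _ (ltS _ _ hj))).
Qed.
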